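(* Fix an integer $\Delta\ge 2$ (treated as a constant). After a precomputation of a table of size $O(n^2)$ in time $O(n^2)$, there is an algorithm which, given the codeword of a tree $T\in T_n^\Delta$, computes the rank of $T$ (its position, starting from $1$, in the list of all trees of $T_n^\Delta$ sorted in A-order) in $O(n)$ time.
   Context: A $T^\Delta$ tree is an unlabeled ordered (plane) rooted tree in which every node has at most $\Delta$ children; $T_n^\Delta$ denotes the set of $T^\Delta$ trees with $n$ nodes. For a tree $T$, $|T|$ is its number of nodes, $\deg(T)$ the number of children of its root, and $T_1,T_2,\dots$ the subtrees rooted at the children of the root from left to right. A-order: for $T^\Delta$ trees $T,T'$ with $k=\max\{\deg(T),\deg(T')\}$, $T\prec_A T'$ iff either $|T|<|T'|$, or $|T|=|T'|$ and for some $1\le i\le k$ one has $T_j=_A T'_j$ for all $j<i$ and $T_i\prec_A T'_i$. The codeword of a $T^\Delta$ tree: the root is labeled $s$; for every internal node, if it has exactly one child that child is labeled $s$, otherwise its leftmost child is labeled $\ell$, its rightmost child $r$, and all children in between $m$; the codeword is the sequence of labels in pre-order. *)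

(* Defs.v *)
From HB Require Import structures.
From mathcomp Require Import all_boot.

Set Implicit Arguments.
Unset Strict Implicit.
Unset Printing Implicit Defensive.

(** * Plane rooted trees *)

Inductive tree : Type := Node of seq tree.

Definition children (t : tree) : seq tree := let: Node s := t in s.

Definition tree_nested_ind (P : tree -> Prop)
    (PNode : forall s, foldr (fun t => and (P t)) True s -> P (Node s)) :
    forall t, P t :=
  fix F (t : tree) : P t :=
    let: Node s := t in
    PNode s ((fix G (s : seq tree) : foldr (fun t => and (P t)) True s :=
      if s is u :: s' then conj (F u) (G s') else I) s).

Fixpoint tree_encode (t : tree) : GenTree.tree void :=
  let: Node s := t in GenTree.Node 0 (map tree_encode s).

Fixpoint tree_decode (g : GenTree.tree void) : tree :=
  if g is GenTree.Node _ s then Node (map tree_decode s) else Node [::].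

Lemma tree_encodeK : cancel tree_encode tree_decode.
Proof.
elim/tree_nested_ind => s /= IHs; congr Node; rewrite -map_comp.
by elim: s IHs => //= t s IHs [-> /IHs ->].
Qed.

HB.instance Definition _ := Countable.copy tree (can_type tree_encodeK).

Fixpoint nnodes (t : tree) : nat :=
  let: Node s := t in (sumn (map nnodes s)).+1.

Definition deg (t : tree) : nat := size (children t).

Fixpoint children_le (Delta : nat) (t : tree) : bool :=
  let: Node s := t in (size s <= Delta) && all (children_le Delta) s.

Definition TDelta (Delta n : nat) : pred tree :=
  [pred t | children_le Delta t & nnodes t == n].

(** * A-order *)

(* [subtree t i] is the mathematical T_(i+1); beyond the degree of the root it
   is the empty tree [None], of size 0. *)
Definition subtree (t : tree) (i : nat) : option tree := onth (children t) i.

Definition onnodes (o : option tree) : nat := if o is Some t then nnodes t else 0.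

Inductive ltA_opt : option tree -> option tree -> Prop :=
| ltA_size o o' : onnodes o < onnodes o' -> ltA_opt o o'
| ltA_subtree t t' i :
    nnodes t = nnodes t' ->
    i < maxn (deg t) (deg t') ->
    (forall j, j < i -> subtree t j = subtree t' j) ->
    ltA_opt (subtree t i) (subtree t' i) ->
    ltA_opt (Some t) (Some t').

Definition ltA (t t' : tree) : Prop := ltA_opt (Some t) (Some t').

Definition A_sorted_list (Delta n : nat) (s : seq tree) : Prop :=
  s =i TDelta Delta n /\
  forall i j, i < j < size s -> ltA (nth (Node [::]) s i) (nth (Node [::]) s j).

Definition is_rank (Delta n : nat) (t : tree) (r : nat) : Prop :=
  exists s : seq tree,
    [/\ A_sorted_list Delta n s, t \in s & r = (index t s).+1].

(** * Codewords *)

Inductive label : Type := Ls | Ll | Lm | Lr.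

(* Label of the child at position [i] (from 0) of a node with [d] children. *)
Definition child_label (d i : nat) : label :=
  if d == 1 then Ls
  else if i == 0 then Ll
  else if i == d.-1 then Lr
  else Lm.

(* Pre-order labels of all nodes but the root. *)
Fixpoint codeword_below (t : tree) : seq label :=
  let: Node s := t in
  flatten [seq p.1 :: p.2
          | p <- zip (mkseq (child_label (size s)) (size s))
                     (map codeword_below s)].

Definition codeword (t : tree) : seq label := Ls :: codeword_below t.

Definition label_code (x : label) : nat :=
  match x with Ls => 0 | Ll => 1 | Lm => 2 | Lr => 3 end.

(** * Uniform-cost random access machine *)

(* Registers and unbounded arrays of natural numbers.  A program names
   finitely many registers and arrays; array cells are addressed through
   registers.  Every elementary instruction and every test costs one unit,
   whatever the size of the numbers involved. *)
Record state : Type := State {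
  reg : nat -> nat;
  arr : nat -> nat -> nat
}.

Definition upd (T : Type) (f : nat -> T) (i : nat) (v : T) : nat -> T :=
  fun j => if j == i then v else f j.

Definition set_reg (st : state) (x v : nat) : state :=
  State (upd (reg st) x v) (arr st).

Definition set_arr (st : state) (a i v : nat) : state :=
  State (reg st) (upd (arr st) a (upd (arr st a) i v)).

Inductive binop : Type := Add | Sub | Mul.

(* [Sub] is truncated subtraction. *)
Definition eval_op (o : binop) : nat -> nat -> nat :=
  match o with Add => addn | Sub => subn | Mul => muln end.

Inductive program : Type :=
| Skip
| Const (x c : nat)                     (* r_x := c *)
| Op (x : nat) (o : binop) (y z : nat)  (* r_x := r_y o r_z *)
| Get (x a y : nat)                     (* r_x := a[r_y] *)
| Put (a x y : nat)                     (* a[r_x] := r_y *)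
| Seq (p q : program)
| If (x y : nat) (p q : program)        (* if r_x < r_y then p else q *)
| While (x y : nat) (p : program).      (* while r_x < r_y do p *)

(* [exec p st k st']: started in [st], [p] halts in [st'] after [k] units of
   time. *)
Inductive exec : program -> state -> nat -> state -> Prop :=
| exec_Skip st : exec Skip st 1 st
| exec_Const st x c : exec (Const x c) st 1 (set_reg st x c)
| exec_Op st x o y z :
    exec (Op x o y z) st 1 (set_reg st x (eval_op o (reg st y) (reg st z)))
| exec_Get st x a y :
    exec (Get x a y) st 1 (set_reg st x (arr st a (reg st y)))
| exec_Put st a x y :
    exec (Put a x y) st 1 (set_arr st a (reg st x) (reg st y))
| exec_Seq st st' st'' p q k l :
    exec p st k st' -> exec q st' l st'' -> exec (Seq p q) st (k + l) st''
| exec_If_true st st' x y p q k :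
    reg st x < reg st y -> exec p st k st' -> exec (If x y p q) st k.+1 st'
| exec_If_false st st' x y p q k :
    reg st y <= reg st x -> exec q st k st' -> exec (If x y p q) st k.+1 st'
| exec_While_false st x y p :
    reg st y <= reg st x -> exec (While x y p) st 1 st
| exec_While_true st st' st'' x y p k l :
    reg st x < reg st y -> exec p st k st' -> exec (While x y p) st' l st'' ->
    exec (While x y p) st (k + l).+1 st''.

Lemma exec_det p st k1 st1 k2 st2 :
  exec p st k1 st1 -> exec p st k2 st2 -> k1 = k2 /\ st1 = st2.
Proof.
move=> e; elim: e k2 st2 => {p st k1 st1}.
1-5: by move=> *; match goal with H : exec _ _ _ _ |- _ => inversion H end.
- move=> > _ IHp _ IHq k2 st2 e; inversion e as [| | | | |? ? ? ? ? ? ? ep eq| | | |].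
  by subst; case: (IHp _ _ ep) => ? ?; subst; case: (IHq _ _ eq) => -> ->.
- move=> > lt _ IHp k2 st2 e.
  inversion e as [| | | | | |? ? ? ? ? ? ? _ ep|? ? ? ? ? ? ? le| |]; subst.
    by case: (IHp _ _ ep) => -> ->.
  by move: lt; rewrite ltnNge le.
- move=> > le _ IHq k2 st2 e.
  inversion e as [| | | | | |? ? ? ? ? ? ? lt|? ? ? ? ? ? ? _ eq| |]; subst.
    by move: lt; rewrite ltnNge le.
  by case: (IHq _ _ eq) => -> ->.
- move=> > le k2 st2 e.
  inversion e as [| | | | | | | | |? ? ? ? ? ? ? ? lt]; subst => //.
  by move: lt; rewrite ltnNge le.
- move=> > lt _ IHp _ IHw k2 st2 e.
  inversion e as [| | | | | | | |? ? ? ? le|? ? ? ? ? ? ? ? _ ep ew]; subst.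
    by move: lt; rewrite ltnNge le.
  by case: (IHp _ _ ep) => ? ?; subst; case: (IHw _ _ ew) => -> ->.
Qed.

(** * Conventions for input and output *)

(* Register 0 holds [n] on input; it holds the numerical result on output.
   Array 0 is the input word and array 1 the precomputed table; all other
   registers and cells are initially 0. *)
Definition init_state (n : nat) (word table : seq nat) : state :=
  State (upd (fun=> 0) 0 n)
        (upd (upd (fun _ _ => 0) 0 (nth 0 word)) 1 (nth 0 table)).

Definition precomputes (pre : program) (n time : nat) (table : seq nat) : Prop :=
  exists k st,
    [/\ exec pre (init_state n [::] [::]) k st, k <= time
      & forall i, arr st 1 i = nth 0 table i].

Definition ranks (rk : program) (Delta n time : nat) (table : seq nat)
    (t : tree) : Prop :=
  exists k st,
    [/\ exec rk (init_state n (map label_code (codeword t)) table) k st,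
        k <= time
      & is_rank Delta n t (reg st 0)].

(* Main.v *)
Require Import Defs.
From mathcomp Require Import all_boot zify.

Set Implicit Arguments.
Unset Strict Implicit.
Unset Printing Implicit Defensive.

(** For trees with equally many nodes, the A-order compares the forests of
    subtrees of the roots lexicographically. Hence the forests of at most [d]
    trees and [m] nodes preceding [T :: F] fall into three groups: those whose
    first tree is smaller than [T], those whose first tree has the size of [T]
    but precedes it, and those starting with [T]. This gives
      [rank d (T :: F) = P d m (|T| - 1) + rank T * N (d - 1) |F| + rank (d - 1) F]
    where [N] counts forests and [P] is a prefix sum of products of values of
    [N]; the table holds all values of [P], and [N d m = P d m m].

    The labels [s] and [l] mark first children, the labels [l] and [m] mark nodes
    with a right sibling, and the subtree of the node at position [i] of the
    codeword is followed by its right sibling. So a single scan from right to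
    left computes, for every node, the size and the ranks of the forest formed by
    its subtree and those of its right siblings. The position of the node among
    its siblings is not known during the scan, so all [d <= Delta] are
    treated. *)

(** * Ranking forests *)

Definition fsize (s : seq tree) : nat := sumn (map nnodes s).

(** The sizes drop to [k] and [m' - k], which is not structural; hence the fuel [N]. Letting [k]
    vary slowest, then [u], then [r], makes the order of the list the A-order. *)
Fixpoint enum_fuel (D N d m : nat) : seq (seq tree) :=
  match m, d, N with
  | 0, _, _ => [:: [::]]
  | m'.+1, d'.+1, N'.+1 =>
      flatten [seq [seq Node u :: r | u <- enum_fuel D N' D k,
                                      r <- enum_fuel D N' d' (m' - k)]
              | k <- iota 0 m'.+1]
  | _, _, _ => [::]
  end.

Definition forests (D d m : nat) : seq (seq tree) := enum_fuel D m d m.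

Definition nforests (D d m : nat) : nat := size (forests D d m).

Lemma enum_fuelSS D N d m :
  enum_fuel D N.+1 d.+1 m.+1 =
  flatten [seq [seq Node u :: r | u <- enum_fuel D N D k,
                                  r <- enum_fuel D N d (m - k)]
          | k <- iota 0 m.+1].
Proof. by []. Qed.

(** Both recursive calls have size at most [m - 1], so the fuel cannot run out. *)
Lemma enum_fuelE D N d m : m <= N -> enum_fuel D N d m = forests D d m.
Proof.
rewrite /forests; elim/ltn_ind: m N d => -[|m] IH [|N] [|d] // lemN.
rewrite !enum_fuelSS; congr flatten; apply/eq_in_map => k; rewrite mem_iota => lek.
by rewrite !(IH k) ?(IH (m - k)) //; lia.
Qed.

Lemma forestsSS D d m :
  forests D d.+1 m.+1 =
  flatten [seq [seq Node u :: r | u <- forests D D k, r <- forests D d (m - k)]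
          | k <- iota 0 m.+1].
Proof.
rewrite {1}/forests enum_fuelSS; congr flatten; apply/eq_in_map => k.
by rewrite mem_iota => lek; rewrite !enum_fuelE //; lia.
Qed.

Lemma mem_forests D d m r :
  (r \in forests D d m) =
  [&& size r <= d, all (children_le D) r & fsize r == m].
Proof.
elim/ltn_ind: m d r => -[|m] IH d r.
  rewrite [LHS]inE; case: r => [|[u] r]; rewrite ?leq0n //=.
  by rewrite /fsize /= !andbF.
case: d => [|d]; first by case: r.
rewrite forestsSS; apply/flatten_mapP/and3P => [[k]|].
  rewrite mem_iota => lek /allpairsP [[u r'] /= [uE rE ->]].
  move: uE rE; rewrite !IH; try lia.
  move=> /and3P [su au /eqP fu] /and3P [sr ar /eqP fr].
  rewrite /= su au ar ltnS sr; split => //; apply/eqP.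
  by move: fu fr lek; rewrite /fsize /=; lia.
case: r => [|[u] r] [] // sr /andP [/andP [su au] ar] /eqP fr.
rewrite -/(all _ u) in au; rewrite -/(all _ r) in ar.
have {}fr : fsize u + fsize r = m by move: fr; rewrite /fsize /=; lia.
exists (fsize u); first by rewrite mem_iota; lia.
apply/allpairsP; exists (u, r); rewrite /= !IH; try lia.
by rewrite su au ar -ltnS sr -fr addKn !eqxx.
Qed.

(* [prefix_count D d m j] counts the forests of at most [d] trees and [m] nodes
   whose first tree has at most [j] nodes. The value [1] at [m = 0] makes the
   diagonal [j = m] equal to [nforests D d m] without exception. *)
Definition prefix_count (D d m j : nat) : nat :=
  match m, d with
  | 0, _ => 1
  | _.+1, 0 => 0
  | m'.+1, d'.+1 => \sum_(k < j) nforests D D k * nforests D d' (m' - k)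
  end.

Lemma prefix_count_diag D d m : prefix_count D d m m = nforests D d m.
Proof.
case: m d => [|m] [|d] //=.
rewrite {3}/nforests forestsSS size_flatten /shape -map_comp sumnE big_map.
rewrite -[in RHS](subn0 m.+1) -/(index_iota 0 m.+1) big_mkord.
by apply: eq_bigr => k _ /=; rewrite size_allpairs.
Qed.

Lemma prefix_count_col0 D d m : prefix_count D d m.+1 0 = 0.
Proof. by case: d => //= d; rewrite big_ord0. Qed.

(** One new summand per column: this lets a table cell be filled in constant time. *)
Lemma prefix_countS D d m j :
  prefix_count D d.+1 m.+1 j.+1 =
  prefix_count D d.+1 m.+1 j + nforests D D j * nforests D d (m - j).
Proof. by rewrite /= big_ord_recr. Qed.

Lemma leq_prefix_count D d m i j :
  i <= j -> prefix_count D d m i <= prefix_count D d m j.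
Proof.
case: m d => [|m] [|d] // /subnKC <-.
by elim: (j - i) => [|l IH]; rewrite ?addn0 ?addnS ?prefix_countS //; lia.
Qed.

(** * Ranks as positions in the enumeration *)

Fixpoint tree_rank (D : nat) (t : tree) {struct t} : nat :=
  let: Node s := t in
  (fix rank (s : seq tree) (d : nat) {struct s} : nat :=
     match s, d with
     | u :: r, d'.+1 =>
         prefix_count D d (fsize s) (nnodes u).-1
         + tree_rank D u * nforests D d' (fsize r) + rank r d'
     | _, _ => 0
     end) s D.

Fixpoint forest_rank (D d : nat) (s : seq tree) : nat :=
  match d, s with
  | d'.+1, u :: r =>
      prefix_count D d (fsize s) (nnodes u).-1
      + tree_rank D u * nforests D d' (fsize r) + forest_rank D d' r
  | _, _ => 0
  end.

Lemma tree_rankE D s : tree_rank D (Node s) = forest_rank D D s.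
Proof.
(* Only the bound on the current list is generalized; subtrees keep the parameter [D]. *)
rewrite /=; move: {4 6}D => d.
by elim: s d => [|u s IH] [|d] //=; rewrite IH.
Qed.

Lemma forest_rank_cons D d u r :
  forest_rank D d.+1 (Node u :: r) =
  prefix_count D d.+1 (fsize u + fsize r).+1 (fsize u)
  + forest_rank D D u * nforests D d (fsize r) + forest_rank D d r.
Proof. by rewrite -tree_rankE. Qed.

(** Used twice to assemble ranks: over the sizes of the first tree, then over the first trees of one
    size. *)
Lemma flatten_iota (w : nat -> nat) b M :
  flatten [seq iota (b + \sum_(i < k) w i) (w k) | k <- iota 0 M] =
  iota b (\sum_(i < M) w i).
Proof.
elim: M => [|M IH]; first by rewrite big_ord0.
by rewrite -addn1 iotaD map_cat flatten_cat IH /= cats0 addn1 big_ord_recr iotaD.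
Qed.

(** The block of size [k] starts at its prefix count, and inside it each [u] owns [c] consecutive
    ranks, numbered by the rank of the remaining forest. *)
Lemma map_forest_rank D d m :
  map (forest_rank D d) (forests D d m) = iota 0 (nforests D d m).
Proof.
elim/ltn_ind: m d => -[|m] IH [|d] //.
rewrite -[in RHS]prefix_count_diag forestsSS map_flatten -map_comp.
rewrite [prefix_count _ _ _ _]/=.
rewrite -(flatten_iota (fun k => nforests D D k * nforests D d (m - k))).
congr flatten; apply/eq_in_map => k; rewrite mem_iota => lek /=.
rewrite map_flatten -map_comp.
set c := nforests D d (m - k); set b := 0 + _.
have -> : nforests D D k * c = \sum_(i < nforests D D k) c.
  by rewrite sum_nat_const card_ord.
rewrite -(flatten_iota (fun=> c)) -IH; last by lia.
rewrite -map_comp; congr flatten; apply/eq_in_map => u.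
rewrite mem_forests /= => /and3P [_ _ /eqP fu].
rewrite sum_nat_const card_ord -map_comp /c.
rewrite -[X in iota X]addn0 iotaDl -IH; last by lia.
rewrite -map_comp; apply/eq_in_map => r.
rewrite mem_forests => /and3P [_ _ /eqP fr].
rewrite [LHS]forest_rank_cons fu fr subnKC /b; last by lia.
by rewrite add0n.
Qed.

Lemma ltn_forest_rank D d m r :
  r \in forests D d m -> forest_rank D d r < nforests D d m.
Proof. by move=> /(map_f (forest_rank D d)); rewrite map_forest_rank mem_iota. Qed.

Lemma index_forests D d m r :
  r \in forests D d m -> index r (forests D d m) = forest_rank D d r.
Proof.
move=> rE; have lti : index r (forests D d m) < nforests D d m by rewrite index_mem.
have <- : nth 0 (iota 0 (nforests D d m)) (index r (forests D d m)) =
          index r (forests D d m) by rewrite nth_iota.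
by rewrite -map_forest_rank (nth_map [::]) // nth_index.
Qed.

Lemma forest_rank_inj D d m :
  {in forests D d m &, injective (forest_rank D d)}.
Proof.
move=> r r' rE rE'; rewrite -(index_forests rE) -(index_forests rE') => eq_i.
by rewrite -(nth_index [::] rE) eq_i nth_index.
Qed.

(** * Ranks and the A-order *)

Definition forest_ltA (r r' : seq tree) : Prop :=
  exists i, [/\ i < maxn (size r) (size r'),
    forall j, j < i -> onth r j = onth r' j & ltA_opt (onth r i) (onth r' i)].

Lemma forest_ltA_head t t' r r' : ltA t t' -> forest_ltA (t :: r) (t' :: r').
Proof. by move=> ltt; exists 0; split; rewrite ?leq_max. Qed.

Lemma forest_ltA_tail t r r' :
  forest_ltA r r' -> forest_ltA (t :: r) (t :: r').
Proof.
case=> i [lti eqr ltr]; exists i.+1; split => //.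
  by move: lti; rewrite !leq_max.
by case=> //= j /eqr.
Qed.

Lemma ltA_Node u u' : fsize u = fsize u' -> forest_ltA u u' -> ltA (Node u) (Node u').
Proof.
move=> eqf [i [lti equ ltu]]; apply: (@ltA_subtree _ _ i) => //.
by rewrite /= -!/(fsize _) eqf.
Qed.

(** Compare the sizes of the first trees, then their ranks, then the tails. A wrong inequality at
    any level contradicts the ranks, since each component rank is below the length of its block. *)
Lemma forest_rank_ltA D d m r r' :
  r \in forests D d m -> r' \in forests D d m ->
  forest_rank D d r < forest_rank D d r' -> forest_ltA r r'.
Proof.
elim/ltn_ind: m d r r' => m IH [|d] [|[u] r] [|[u'] r'] //.
  by rewrite !mem_forests => /and3P [_ _ /eqP <-]; rewrite /fsize /= !andbF.
case: m IH => [|m] IH; first by rewrite mem_forests /fsize /= !andbF.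
rewrite !mem_forests => /and3P [sr /andP [/andP [su au] ar] /eqP fr].
move=> /and3P [sr' /andP [/andP [su' au'] ar'] /eqP fr'].
rewrite -/(all _ u) in au; rewrite -/(all _ r) in ar.
rewrite -/(all _ u') in au'; rewrite -/(all _ r') in ar'.
have {}fr : fsize u + fsize r = m by move: fr; rewrite /fsize /=; lia.
have {}fr' : fsize u' + fsize r' = m by move: fr'; rewrite /fsize /=; lia.
rewrite !forest_rank_cons fr fr'.
have uE : u \in forests D D (fsize u) by rewrite mem_forests su au eqxx.
have uE' : u' \in forests D D (fsize u') by rewrite mem_forests su' au' eqxx.
have rE : r \in forests D d (fsize r) by rewrite mem_forests -ltnS sr ar eqxx.
have rE' : r' \in forests D d (fsize r') by rewrite mem_forests -ltnS sr' ar' eqxx.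
have ltr := ltn_forest_rank rE; have ltr' := ltn_forest_rank rE'.
have ltu' := ltn_forest_rank uE'.
case: (ltngtP (fsize u) (fsize u')) => [ltf|ltf|eqf].
- by move=> _; apply: forest_ltA_head; apply: ltA_size; rewrite /= -!/(fsize _).
(* The prefix up to [fsize u] already contains the whole block of size [fsize u']. *)
- have := @leq_prefix_count D d.+1 m.+1 _ _ ltf.
  rewrite prefix_countS -fr' addKn; nia.
have eqf' : fsize r = fsize r' by lia.
rewrite -eqf' in ltr' rE' *; rewrite -eqf in uE' ltu' *.
case: (ltngtP (forest_rank D D u) (forest_rank D D u')) => [lt_u|lt_u|eq_u].
- move=> _; apply/forest_ltA_head/ltA_Node => //.
  by apply: (IH (fsize u) _ D) => //; lia.
- by nia.
- rewrite eq_u ltn_add2l => lt_r; rewrite (forest_rank_inj uE uE' eq_u).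
  by apply/forest_ltA_tail/(IH (fsize r) _ d) => //; lia.
Qed.

Lemma is_rank_forest_rank D n s :
  Node s \in TDelta D n -> is_rank D n (Node s) (forest_rank D D s).+1.
Proof.
(* Stripping the root leaves [n.-1] nodes; [0 < n] excludes the one-node tree when [n = 0]. *)
have Node_inj : injective Node by move=> ? ? [].
have in_Node t : (t \in TDelta D n) = (t \in map Node (forests D D n.-1)) && (0 < n).
  case: t => u; rewrite mem_map // mem_forests inE /= -/(fsize u).
  by case: n => [|n]; rewrite ?andbF //= andbT andbA.
move=> sT; have := sT; rewrite in_Node => /andP [sE n_gt0].
exists (map Node (forests D D n.-1)); split => //; last first.
  by rewrite index_map // index_forests // -(mem_map Node_inj).
split=> [t|i j]; first by rewrite in_Node n_gt0 andbT.
rewrite size_map => /andP [ltij ltj]; have lti := ltn_trans ltij ltj.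
rewrite !(nth_map [::]) //; have mi := mem_nth [::] lti; have mj := mem_nth [::] ltj.
apply: ltA_Node.
  by move: mi mj; rewrite !mem_forests => /and3P [_ _ /eqP ->] /and3P [_ _ /eqP ->].
have rk k : k < nforests D D n.-1 ->
    forest_rank D D (nth [::] (forests D D n.-1) k) = k.
  by move=> ltk; rewrite -(nth_map _ 0) // map_forest_rank nth_iota.
by apply: (forest_rank_ltA mi mj); rewrite !rk.
Qed.

(** * Codewords *)

(* Pre-order list of the nodes of a forest whose trees are the children number
   [p], [p + 1], ... of a node of degree [d]: each node comes with its label and
   with the forest formed by its subtree and those of its right siblings. *)
Fixpoint tree_sites (d p : nat) (ts : seq tree) (t : tree) {struct t} :
    seq (label * seq tree) :=
  let: Node c := t in
  (child_label d p, t :: ts) ::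
  (fix sites (p : nat) (s : seq tree) {struct s} :=
     if s is u :: r then tree_sites (size c) p r u ++ sites p.+1 r else [::]) 0 c.

Fixpoint sites (d p : nat) (s : seq tree) : seq (label * seq tree) :=
  if s is u :: r then tree_sites d p r u ++ sites d p.+1 r else [::].

Lemma sites_cons d p c r :
  sites d p (Node c :: r) =
  (child_label d p, Node c :: r) :: sites (size c) 0 c ++ sites d p.+1 r.
Proof.
rewrite /=; congr (_ :: _ ++ _); move: 0 => q; move: (size c) => e.
by elim: c q => //= u c IH q; rewrite IH.
Qed.

(** Induction along first child and right sibling, the view of a forest as a binary tree. *)
Lemma forest_ind (P : seq tree -> Prop) :
  P [::] -> (forall c r, P c -> P r -> P (Node c :: r)) -> forall s, P s.
Proof.
move=> P0 PS; suff Pt t : P (children t) by move=> s; apply: (Pt (Node s)).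
elim/tree_nested_ind: t => s /=.
by elim: s => // -[c] r IH /= [Pc /IH]; apply: PS.
Qed.

Lemma fsize_cons c r : fsize (Node c :: r) = (fsize c + fsize r).+1.
Proof. by []. Qed.

Lemma size_sites d p s : size (sites d p s) = fsize s.
Proof.
elim/forest_ind: s d p => // c r IHc IHr d p.
by rewrite sites_cons /= size_cat IHc IHr.
Qed.

Lemma map_fst_sites d p s :
  map fst (sites d p s) =
  flatten [seq q.1 :: q.2 | q <- zip (map (child_label d) (iota p (size s)))
                                     (map codeword_below s)].
Proof.
elim/forest_ind: s d p => // c r IHc IHr d p.
by rewrite sites_cons /= map_cat IHc IHr.
Qed.

Lemma codewordE s : codeword (Node s) = Ls :: map fst (sites (size s) 0 s).
Proof. by rewrite map_fst_sites. Qed.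

Lemma leq_fsize_sites d p s i :
  fsize (nth (Ls, [::]) (sites d p s) i).2 <= fsize s.
Proof.
elim/forest_ind: s d p i => [|c r IHc IHr] d p i; first by rewrite nth_nil.
rewrite sites_cons fsize_cons; case: i => [|i] //=.
rewrite nth_cat; case: ifP => _; first by have := IHc (size c) 0 i; lia.
by have := IHr d p.+1 (i - size (sites (size c) 0 c)); lia.
Qed.

Definition first_label (x : label) : bool := label_code x < 2.

Definition has_next_label (x : label) : bool := 0 < label_code x < 3.

(* What the labels alone reveal of the first site of a list [z]. Past the end,
   the default label [Ls] (code 0, as in an unwritten cell) wrongly announces a
   first child, which is harmless because the default forest is empty. *)
Definition site_ok (z : seq (label * seq tree)) : Prop :=
  exists c ts,
    [/\ (nth (Ls, [::]) z 0).2 = Node c :: ts,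
        c = (if first_label (nth (Ls, [::]) z 1).1
             then (nth (Ls, [::]) z 1).2 else [::])
      & ts = (if has_next_label (nth (Ls, [::]) z 0).1
              then (nth (Ls, [::]) z (fsize c).+1).2 else [::])].

Lemma first_child_label d p : p < d -> first_label (child_label d p) = (p == 0).
Proof.
rewrite /child_label; case: eqP => [->|d1]; first by case: p.
by case: eqP => // p0; case: eqP.
Qed.

Lemma has_next_child_label d p :
  p < d -> has_next_label (child_label d p) = (p.+1 < d).
Proof.
rewrite /child_label; case: eqP => [->|d1]; first by case: p.
by case: eqP => [->|p0]; last case: eqP; rewrite /has_next_label /=; lia.
Qed.

(** Generalized over the continuation [z] of the pre-order. If [z] began with a first child, a
    preceding leaf would seem to own it; the default [Lr] lets an empty [z] pass. *)
Lemma sites_site_ok d p s z :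
  p + size s = d ->
  ~~ first_label (nth (Lr, [::]) z 0).1 ->
  (forall i, i < size z -> site_ok (drop i z)) ->
  forall i, i < size (sites d p s ++ z) -> site_ok (drop i (sites d p s ++ z)).
Proof.
elim/forest_ind: s d p z => // c r IHc IHr d p z szd zhead zok.
have {}IHr := IHr d p.+1 z (etrans (addSnnS _ _) szd) zhead zok.
(* After the subtree comes a right sibling, at position [p.+1 > 0], or else [z]. *)
have z'head : ~~ first_label (nth (Lr, [::]) (sites d p.+1 r ++ z) 0).1.
  move: szd zhead; clear; case: r => [|[b] r] //= szd _.
  by rewrite first_child_label //; lia.
set z' := sites d p.+1 r ++ z in IHr z'head *.
have {}IHc := IHc (size c) 0 z' erefl z'head IHr.
rewrite sites_cons /= -catA -/z' => -[|i] //; last exact: IHc.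
move=> _; exists c, r; split=> //=.
- move: z'head; case: c {IHc szd} => [|[b] c] /=.
    by case: z' {IHr} => [|[x s] z'] //= /negPf ->.
  by rewrite first_child_label.
- rewrite has_next_child_label; last by rewrite -szd /=; lia.
  (* Skipping the [fsize c] sites below the node lands exactly on the right sibling. *)
  rewrite nth_cat size_sites ltnn subnn /z'.
  move: szd; clear; case: r => [|[b] r] /= szd; first by rewrite ifF //; lia.
  by rewrite ifT //; lia.
Qed.

(** * Compiling expressions *)

Inductive expr : Type :=
| Var (x : nat)
| Lit (c : nat)
| Bin (o : binop) (e f : expr)
| Cell (a : nat) (e : expr).

Fixpoint eval (st : state) (e : expr) : nat :=
  match e with
  | Var x => reg st x
  | Lit c => c
  | Bin o e f => eval_op o (eval st e) (eval st f)
  | Cell a e => arr st a (eval st e)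
  end.

Fixpoint vars_below (x : nat) (e : expr) : bool :=
  match e with
  | Var y => y < x
  | Lit _ => true
  | Bin _ e f => vars_below x e && vars_below x f
  | Cell _ e => vars_below x e
  end.

(* The value of the expression ends up in [x]; the registers beyond [x] are
   scratch space. *)
Fixpoint compile (x : nat) (e : expr) : program :=
  match e with
  | Var y => Seq (Const x 0) (Op x Add x y)
  | Lit c => Const x c
  | Bin o e f => Seq (compile x e) (Seq (compile x.+1 f) (Op x o x x.+1))
  | Cell a e => Seq (compile x e) (Get x a x)
  end.

(** Independent of the state, so a fixed block takes constant time. *)
Fixpoint cost (e : expr) : nat :=
  match e with
  | Var _ => 2
  | Lit _ => 1
  | Bin _ e f => cost e + (cost f + 1)
  | Cell _ e => cost e + 1
  end.

Definition agree (x : nat) (st st' : state) : Prop :=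
  (forall y, y < x -> reg st' y = reg st y) /\ arr st' = arr st.

Lemma eval_agree x st st' e :
  agree x st st' -> vars_below x e -> eval st' e = eval st e.
Proof.
case=> eqr eqa; elim: e => [y|c|o e IHe f IHf|a e IHe] //=; first exact: eqr.
  by case/andP=> /IHe -> /IHf ->.
by move=> /IHe ->; rewrite eqa.
Qed.

Lemma vars_belowW x y e : x <= y -> vars_below x e -> vars_below y e.
Proof.
move=> le_xy; elim: e => [z|c|o e IHe f IHf|a e IHe] //=.
  by move=> lt_zx; apply: leq_trans lt_zx le_xy.
by case/andP=> /IHe -> /IHf ->.
Qed.

Lemma upd_eq T (f : nat -> T) i v : upd f i v i = v.
Proof. by rewrite /upd eqxx. Qed.

Lemma upd_neq T (f : nat -> T) i j v : j != i -> upd f i v j = f j.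
Proof. by rewrite /upd => /negPf ->. Qed.

Lemma exec_compile x e st :
  vars_below x e ->
  exists st', [/\ exec (compile x e) st (cost e) st', reg st' x = eval st e
                & agree x st st'].
Proof.
elim: e x st => [y|c|o e IHe f IHf|a e IHe] x st /=.
- move=> lt_yx; eexists; split.
  + by apply: (@exec_Seq _ _ _ _ _ 1 1); constructor.
  + by rewrite /= upd_eq /= upd_eq upd_neq // ltn_eqF.
  + by split=> // z lt_zx; rewrite /= !upd_neq // ltn_eqF.
- move=> _; eexists; split; first by constructor.
    by rewrite /= upd_eq.
  by split=> // z lt_zx; rewrite /= !upd_neq // ltn_eqF.
- case/andP=> /IHe {}IHe fx; case: (IHe st) => st1 [e1 r1 a1].
  have [st2 [e2 r2 a2]] := IHf x.+1 st1 (vars_belowW (leqnSn x) fx).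
  eexists; split.
  + by apply: exec_Seq e1 _; apply: exec_Seq e2 _; constructor.
  + by rewrite /= upd_eq r2 (eval_agree a1) // (proj1 a2) // r1.
  + split=> [z lt_zx|]; last by rewrite /= (proj2 a2) (proj2 a1).
    by rewrite /= upd_neq ?ltn_eqF // (proj1 a2) ?(proj1 a1) // ltnS ltnW.
- move=> /IHe {}IHe; case: (IHe st) => st1 [e1 r1 a1].
  eexists; split; first by apply: exec_Seq e1 _; constructor.
    by rewrite /= upd_eq r1 (proj2 a1).
  split=> [z lt_zx|]; last exact: (proj2 a1).
  by rewrite /= upd_neq ?ltn_eqF // (proj1 a1).
Qed.

(** * Straight-line blocks and loops *)

Inductive stmt : Type :=
| Assign (x : nat) (e : expr)
| Store (a : nat) (e f : expr).

Definition run_stmt (st : state) (s : stmt) : state :=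
  match s with
  | Assign x e => set_reg st x (eval st e)
  | Store a e f => set_arr st a (eval st e) (eval st f)
  end.

Definition run (st : state) (b : seq stmt) : state := foldl run_stmt st b.

(* Programs compiled from statements keep their variables below [nvars]. *)
Definition nvars : nat := 10.

Definition stmt_ok (s : stmt) : bool :=
  match s with
  | Assign x e => (x < nvars) && vars_below nvars e
  | Store _ e f => vars_below nvars e && vars_below nvars f
  end.

Definition compile_stmt (s : stmt) : program :=
  match s with
  | Assign x e =>
      Seq (compile nvars e) (Seq (Const x 0) (Op x Add x nvars))
  | Store a e f =>
      Seq (compile nvars e) (Seq (compile nvars.+1 f) (Put a nvars nvars.+1))
  end.

Definition cost_stmt (s : stmt) : nat :=
  match s with
  | Assign _ e => cost e + 2
  | Store _ e f => cost e + (cost f + 1)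
  end.

Definition block (b : seq stmt) : program :=
  foldr (fun s => Seq (compile_stmt s)) Skip b.

Definition cost_block (b : seq stmt) : nat := (sumn (map cost_stmt b)).+1.

Lemma exec_stmt s st :
  stmt_ok s ->
  exists2 st', exec (compile_stmt s) st (cost_stmt s) st'
             & agree nvars (run_stmt st s) st'.
Proof.
case: s => [x e|a e f] /= /andP [].
  move=> lt_x eok; have [st1 [e1 r1 a1]] := exec_compile st eok.
  eexists; first by apply: exec_Seq e1 _; apply: (@exec_Seq _ _ _ _ _ 1 1); constructor.
  split=> [y lt_y|]; last exact: (proj2 a1).
  have [->|neq_yx] := eqVneq y x; last by rewrite /= !upd_neq // (proj1 a1).
  by rewrite /= !upd_eq add0n upd_neq ?r1 // gtn_eqF.
move=> eok fok; have [st1 [e1 r1 a1]] := exec_compile st eok.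
have [st2 [e2 r2 a2]] := exec_compile st1 (vars_belowW (leqnSn _) fok).
eexists; first by apply: exec_Seq e1 _; apply: exec_Seq e2 _; constructor.
split=> [y lt_y|] /=; first by rewrite (proj1 a2) ?(proj1 a1) // ltnW.
by rewrite r2 (eval_agree a1) // (proj1 a2) // r1 (proj2 a2) (proj2 a1).
Qed.

Lemma run_stmt_agree s st st' :
  stmt_ok s -> agree nvars st st' -> agree nvars (run_stmt st s) (run_stmt st' s).
Proof.
move=> + ast; case: s => [x e|a e f] /= /andP [].
  move=> _ eok; rewrite (eval_agree ast) //; split; last exact: (proj2 ast).
  by move=> y lt_y; rewrite /= /upd (proj1 ast).
move=> eok fok; rewrite !(eval_agree ast) //; split; first exact: (proj1 ast).
by rewrite /= (proj2 ast).
Qed.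

Lemma agree_trans x st1 st2 st3 :
  agree x st1 st2 -> agree x st2 st3 -> agree x st1 st3.
Proof.
move=> [r12 a12] [r23 a23]; split; last by rewrite a23.
by move=> y lt_y; rewrite r23 ?r12.
Qed.

Lemma run_agree b st st' :
  all stmt_ok b -> agree nvars st st' -> agree nvars (run st b) (run st' b).
Proof.
elim: b st st' => //= s b IH st st' /andP [sok bok] ast.
exact/IH/run_stmt_agree.
Qed.

(** Reduces reasoning about the machine to [run], up to scratch registers. *)
Lemma exec_block b st :
  all stmt_ok b ->
  exists2 st', exec (block b) st (cost_block b) st' & agree nvars (run st b) st'.
Proof.
elim: b st => [|s b IH] st /=; first by exists st; first constructor.
case/andP=> sok bok; have [st1 e1 a1] := exec_stmt st sok.
have [st2 e2 a2] := IH st1 bok; exists st2.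
  by rewrite /cost_block /= -addnS; apply: exec_Seq e1 e2.
exact: agree_trans (run_agree bok a1) a2.
Qed.

(** The index of the invariant counts the iterations left; each costs at most [c] and one test, and
    one last test ends the loop. *)
Lemma exec_while (I : nat -> state -> Prop) x y p c :
  (forall k st, I k.+1 st -> reg st x < reg st y /\
     exists t st', [/\ exec p st t st', t <= c & I k st']) ->
  (forall st, I 0 st -> reg st y <= reg st x) ->
  forall k st, I k st ->
  exists t st', [/\ exec (While x y p) st t st', t <= (k * c.+1).+1 & I 0 st'].
Proof.
move=> step stop; elim=> [|k IH] st Ist.
  by exists 1, st; split=> //; apply: exec_While_false; apply: stop.
have [lt_xy [t1 [st1 [e1 t1c I1]]]] := step _ _ Ist.
have [t2 [st2 [e2 t2c I2]]] := IH _ I1.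
exists (t1 + t2).+1, st2; split=> //; first exact: exec_While_true e1 e2.
by rewrite mulSn; lia.
Qed.

(** * The precomputation *)

(** Row-major flattening of a three-dimensional table; division by [n] recovers the coordinates when
    [m, j < n]. *)
Definition tindex (n d m j : nat) : nat := (d * n + m) * n + j.

Lemma tindex_inj n d m j d' m' j' :
  m < n -> j < n -> m' < n -> j' < n ->
  tindex n d m j = tindex n d' m' j' -> [/\ d = d', m = m' & j = j'].
Proof.
move=> mn jn mn' jn' eqi; have n0 : 0 < n by lia.
have eqj : j = j'.
  by have := congr1 (modn^~ n) eqi; rewrite /tindex /= !modnMDl !modn_small.
have eqq : d * n + m = d' * n + m'.
  have := congr1 (divn^~ n) eqi.
  by rewrite /tindex /= !divnMDl // !divn_small // !addn0.
have eqm : m = m' by have := congr1 (modn^~ n) eqq; rewrite /= !modnMDl !modn_small.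
split=> //.
by have := congr1 (divn^~ n) eqq; rewrite /= !divnMDl // !divn_small // !addn0.
Qed.

Lemma ltn_tindex D n d m j :
  d <= D -> m < n -> j < n -> tindex n d m j < D.+1 * n * n.
Proof.
move=> dD mn jn; have dn : d * n + m < D.+1 * n.
  by have := leq_mul dD (leqnn n); rewrite mulSn; lia.
by have := leq_mul dn (leqnn n); rewrite /tindex mulSn; lia.
Qed.

(** Cells not yet filled hold 0, so a cell whose count is 0 may be declared filled without being
    written. *)
Definition table_inv (D n : nat) (filled : nat -> nat -> nat -> bool)
    (T : nat -> nat) : Prop :=
  (forall d m j, d <= D -> j <= m -> m < n ->
     T (tindex n d m j) = if filled d m j then prefix_count D d m j else 0) /\
  (forall i, D.+1 * n * n <= i -> T i = 0).

Lemma table_inv_ext D n filled filled' T :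
  (forall d m j, d <= D -> j <= m -> m < n ->
     filled d m j = filled' d m j \/ prefix_count D d m j = 0) ->
  table_inv D n filled T -> table_inv D n filled' T.
Proof.
move=> eqf [Tin Tout]; split=> // d m j dD jm mn; rewrite Tin //.
by case: (eqf d m j dD jm mn) => [->|->] //; do 2 case: ifP.
Qed.

Lemma table_inv_upd D n filled T d m j :
  d <= D -> j <= m -> m < n -> table_inv D n filled T ->
  table_inv D n (fun d' m' j' => filled d' m' j' || [&& d' == d, m' == m & j' == j])
    (upd T (tindex n d m j) (prefix_count D d m j)).
Proof.
move=> dD jm mn [Tin Tout]; split=> [d' m' j' dD' jm' mn'|i lei]; last first.
  rewrite upd_neq ?Tout //; apply: contraTneq lei => ->.
  by rewrite -ltnNge ltn_tindex //; lia.
rewrite {1}/upd; case: eqP => [eqi|neqi].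
  case: (@tindex_inj n d' m' j' d m j) => // [||-> -> ->]; try lia.
  by rewrite !eqxx orbT.
rewrite Tin //; case: and3P => [[/eqP ed /eqP em /eqP ej]|]; last by rewrite orbF.
by case: neqi; rewrite ed em ej.
Qed.

(** * The program filling the table *)

Definition tcell (d : nat) (m j : expr) : expr :=
  Cell 1 (Bin Add (Bin Mul (Bin Add (Bin Mul (Lit d) (Var 0)) m) (Var 0)) j).

Definition tstore (d : nat) (m j e : expr) : stmt :=
  Store 1 (Bin Add (Bin Mul (Bin Add (Bin Mul (Lit d) (Var 0)) m) (Var 0)) j) e.

(* Registers: 0 holds [n], 1 the number [m] of nodes, 2 the column [j]. *)

Definition fill_row0 (d : nat) : stmt := tstore d (Lit 0) (Lit 0) (Lit 1).

Definition fill_next (D d : nat) : stmt :=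
  let k := Bin Defs.Sub (Bin Defs.Sub (Var 1) (Lit 1)) (Var 2) in
  tstore d (Var 1) (Bin Add (Var 2) (Lit 1))
    (Bin Add (tcell d (Var 1) (Var 2))
       (Bin Mul (tcell D (Var 2) (Var 2)) (tcell d.-1 k k))).

Definition pre_init (D : nat) : seq stmt :=
  map fill_row0 (iota 0 D.+1) ++ [:: Assign 1 (Lit 1)].

Definition pre_step (D : nat) : seq stmt :=
  map (fill_next D) (iota 1 D) ++ [:: Assign 2 (Bin Add (Var 2) (Lit 1))].

Definition reset_column : seq stmt := [:: Assign 2 (Lit 0)].

Definition next_row : seq stmt := [:: Assign 1 (Bin Add (Var 1) (Lit 1))].

Definition pre_program (D : nat) : program :=
  Seq (block (pre_init D))
      (While 1 0 (Seq (block reset_column)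
                      (Seq (While 2 1 (block (pre_step D))) (block next_row)))).

Definition row0_filled (e d m j : nat) : bool := (m == 0) && (d < e).

(** The frontier of the computation: all rows before [m], the columns up to [j] of row [m], and
    column [j + 1] for the bounds below [e]. *)
Definition cells_filled (m j e d' m' j' : nat) : bool :=
  (m' < m) || (m' == m) && ((j' <= j) || (j' == j.+1) && (d' < e)).

Lemma run_cat st b b' : run st (b ++ b') = run (run st b) b'.
Proof. exact: foldl_cat. Qed.

Lemma run_fill_row0 D n st e :
  reg st 0 = n -> 0 < n -> e <= D.+1 ->
  table_inv D n (fun _ _ _ => false) (arr st 1) ->
  reg (run st (map fill_row0 (iota 0 e))) = reg st /\
  table_inv D n (row0_filled e) (arr (run st (map fill_row0 (iota 0 e))) 1).
Proof.
move=> r0 n0 + Tinv; elim: e => [|e IH] leD.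
  split=> //; apply: table_inv_ext Tinv => d m j _ _ _; left.
  by rewrite /row0_filled ltn0 andbF.
rewrite -addn1 iotaD map_cat run_cat /=; move: (run st _) (IH (ltnW leD)).
move=> st1 [r1 inv1]; split=> //.
rewrite /= upd_eq r1 r0 -/(tindex n e 0 0).
apply: table_inv_ext (@table_inv_upd D n _ _ e 0 0 _ _ _ inv1) => //.
move=> d m j _ jm _; left; rewrite /row0_filled; lia.
Qed.

Lemma run_fill_next D n st m j e :
  reg st 0 = n -> reg st 1 = m -> reg st 2 = j ->
  m < n -> j < m -> e <= D ->
  table_inv D n (cells_filled m j 1) (arr st 1) ->
  reg (run st (map (fill_next D) (iota 1 e))) = reg st /\
  table_inv D n (cells_filled m j e.+1)
    (arr (run st (map (fill_next D) (iota 1 e))) 1).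
Proof.
move=> r0 r1 r2 mn jm + Tinv; elim: e => [|e IH] leD //.
have -> : iota 1 e.+1 = iota 1 e ++ [:: e.+1] by rewrite -(addn1 e) iotaD add1n addn1.
rewrite map_cat run_cat; move: (run st _) (IH (ltnW leD)).
move=> st1 [eqr inv1]; split=> //.
rewrite /= upd_eq eqr r0 r1 r2 -!/(tindex n _ _ _).
have -> : arr st1 1 (tindex n e.+1 m j) +
    arr st1 1 (tindex n D j j) *
    arr st1 1 (tindex n e (m - 1 - j) (m - 1 - j)) = prefix_count D e.+1 m j.+1.
  rewrite !(proj1 inv1); try lia.
  (* All three cells read lie behind the frontier: column [j] of row [m], and rows [j] and
     [m - 1 - j], both below [m]. *)
  rewrite !ifT; try (rewrite /cells_filled; lia).
  case: m jm {mn r1 inv1 Tinv IH} => // m jm.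
  by rewrite prefix_countS !prefix_count_diag subn1.
rewrite addn1.
apply: table_inv_ext (@table_inv_upd D n _ _ e.+1 m j.+1 _ _ _ inv1) => //.
by move=> d' m' j' _ _ _; left; rewrite /cells_filled; lia.
Qed.

Definition pre_state (D n m j : nat) (st : state) : Prop :=
  [/\ reg st 0 = n, reg st 1 = m, reg st 2 = j
    & table_inv D n (cells_filled m j 1) (arr st 1)].

Lemma all_stmt_ok_map (f : nat -> stmt) s :
  (forall d, stmt_ok (f d)) -> all stmt_ok (map f s).
Proof. by move=> fok; rewrite all_map; apply/allP => d _; apply: fok. Qed.

Lemma exec_pre_step D n m j st :
  pre_state D n m j st -> m < n -> j < m ->
  exists t st', [/\ exec (block (pre_step D)) st t st',
    t <= cost_block (pre_step D) & pre_state D n m j.+1 st'].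
Proof.
case=> r0 r1 r2 inv mn jm.
have [|st' e [ar aa]] := @exec_block (pre_step D) st.
  by rewrite all_cat all_stmt_ok_map.
exists (cost_block (pre_step D)), st'; split=> //.
have [] := run_fill_next r0 r1 r2 mn jm (leqnn D) inv.
move: ar aa; rewrite /pre_step run_cat; move: (run st _) => st1 ar aa eqr inv1.
split; [| | |]; rewrite ?ar ?aa //= /upd /= ?eqr ?r2 ?addn1 //.
apply: table_inv_ext inv1 => d' m' j' dD _ _.
(* Only cells of row [m] with bound 0 change status; their count is 0 because [m > 0]. *)
case: (eqVneq (d', m') (0, m)) => [[-> ->]|ne].
  by right; case: (m) jm.
left; rewrite /cells_filled; move: ne; rewrite xpair_eqE; lia.
Qed.

Lemma exec_assign x e st :
  x < nvars -> vars_below nvars e ->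
  exists t st', [/\ exec (block [:: Assign x e]) st t st',
    t <= cost_block [:: Assign x e] & agree nvars (set_reg st x (eval st e)) st'].
Proof.
move=> xok eok; have [|st' ex a] := @exec_block [:: Assign x e] st.
  by rewrite /= xok eok.
by exists (cost_block [:: Assign x e]), st'.
Qed.

Lemma exec_pre_row D n m st :
  reg st 0 = n -> reg st 1 = m -> table_inv D n (cells_filled m 0 1) (arr st 1) ->
  m < n ->
  exists t st',
    [/\ exec (Seq (block reset_column)
                  (Seq (While 2 1 (block (pre_step D))) (block next_row))) st t st',
        t <= 20 + n * (cost_block (pre_step D)).+1,
        reg st' 0 = n, reg st' 1 = m.+1
      & table_inv D n (cells_filled m.+1 0 1) (arr st' 1)].
Proof.
move=> r0 r1 inv mn.
have [t1 [st1 [e1 le1 [a1 b1]]]] := @exec_assign 2 (Lit 0) st isT isT.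
have inv1 : pre_state D n m (m - m) st1.
  by split; rewrite ?a1 ?b1 /= /upd //= subnn.
pose I k s := k <= m /\ pre_state D n m (m - k) s.
have step k s : I k.+1 s -> reg s 2 < reg s 1 /\ exists t s',
    [/\ exec (block (pre_step D)) s t s', t <= cost_block (pre_step D) & I k s'].
  case=> ltk ps; case: (ps) => _ -> -> _; split; first by lia.
  have [|t [s' [es les ps']]] := exec_pre_step ps mn; first by lia.
  exists t, s'; split=> //; split; first exact: ltnW.
  by rewrite (_ : m - k = (m - k.+1).+1) //; lia.
have stop s : I 0 s -> reg s 1 <= reg s 2 by case=> _ [_ -> -> _]; rewrite subn0.
have [t2 [st2 [e2 le2 [_ [r02 r12 r22 inv2]]]]] :=
  exec_while step stop (conj (leqnn m) inv1).
have [t3 [st3 [e3 le3 [a3 b3]]]] :=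
  @exec_assign 1 (Bin Add (Var 1) (Lit 1)) st2 isT isT.
exists (t1 + (t2 + t3)), st3; split.
- exact: exec_Seq e1 (exec_Seq e2 e3).
- have := leq_mul (ltnW mn) (leqnn (cost_block (pre_step D)).+1).
  move: le2; move: (m * _) (n * _) => a b.
  move: le1 le3; rewrite /cost_block /=; lia.
- by rewrite a3.
- by rewrite a3 //= /upd /= r12 addn1.
rewrite b3 /=; apply: table_inv_ext inv2 => d' m' j' _ jm' _.
case: (eqVneq m' m.+1) => [->|ne].
  case: (posnP j') => [->|j0]; first by right; apply: prefix_count_col0.
  case: (posnP d') => [->|d0]; first by right.
  by left; rewrite /cells_filled; lia.
by left; rewrite /cells_filled; lia.
Qed.

Lemma precomputes_table D n :
  0 < n ->
  exists table : seq nat,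
    [/\ size table <= D.+1 * n ^ 2,
        precomputes (pre_program D) n
          ((cost_block (pre_init D) + cost_block (pre_step D) + 23) * n ^ 2) table
      & forall d m j, d <= D -> j <= m -> m < n ->
          nth 0 table (tindex n d m j) = prefix_count D d m j].
Proof.
move=> n0; set st := init_state n [::] [::].
have inv0 : table_inv D n (fun _ _ _ => false) (arr st 1).
  by split=> *; rewrite /= /upd /= nth_nil.
have [|st1 e1 [ar aa]] := @exec_block (pre_init D) st.
  by rewrite all_cat all_stmt_ok_map.
have [] := @run_fill_row0 D n st D.+1 erefl n0 (leqnn _) inv0.
move: ar aa; rewrite /pre_init run_cat; move: (run st _) => st' ar aa eqr inv.
(* Row 0 has been written; the cells added in row 1, those of column 0 or with bound 0, have count
   0. *)
have {inv} inv1 : table_inv D n (cells_filled 1 0 1) (arr st1 1).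
  rewrite aa /=; apply: table_inv_ext inv => d m j dD jm mn.
  rewrite /row0_filled /cells_filled ltnS dD andbT.
  case: m jm mn => [|[|m]] jm mn; [by left| |by left].
  case: j jm => [|[|j]] //= _; first by right; apply: prefix_count_col0.
  by case: d dD => [|d] dD; [right|left].
have r0 : reg st1 0 = n by rewrite ar //= /upd /= eqr.
have r1 : reg st1 1 = n - n.-1 by rewrite ar //= /upd /=; lia.
pose I k s := [/\ k < n, reg s 0 = n, reg s 1 = n - k
                & table_inv D n (cells_filled (n - k) 0 1) (arr s 1)].
pose row := Seq (block reset_column)
                (Seq (While 2 1 (block (pre_step D))) (block next_row)).
have step k s : I k.+1 s -> reg s 1 < reg s 0 /\ exists t s',
    [/\ exec row s t s', t <= 20 + n * (cost_block (pre_step D)).+1 & I k s'].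
  case=> ltk q0 q1 inv; split; first by rewrite q0 q1; lia.
  have [|t [s' [es les q0' q1' inv']]] := exec_pre_row q0 q1 inv; first by lia.
  have eqk : n - k = (n - k.+1).+1 by lia.
  by exists t, s'; split=> //; split; rewrite ?eqk //; lia.
have stop s : I 0 s -> reg s 0 <= reg s 1 by case=> _ -> ->; rewrite subn0.
have I1 : I n.-1 st1.
  by split=> //; [lia|rewrite (_ : n - n.-1 = 1) //; lia].
have [t2 [st2 [e2 le2 [_ _ _ [Tin Tout]]]]] := exec_while step stop I1.
(* Beyond this length the array is 0, the default value of [nth]. *)
exists (mkseq (arr st2 1) (D.+1 * n * n)); split.
- by rewrite size_mkseq -mulnA mulnn.
- exists (cost_block (pre_init D) + t2), st2; split; first exact: exec_Seq e1 e2.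
    have n1 : n.-1 <= n by lia.
    have := leq_mul n1 (leqnn (20 + n * (cost_block (pre_step D)).+1).+1).
    rewrite -mulnn; move: (cost_block _) (cost_block _) le2 => a b; nia.
  move=> i; case: (ltnP i (D.+1 * n * n)) => lti; first by rewrite nth_mkseq.
  by rewrite nth_default ?Tout // size_mkseq.
- move=> d m j dD jm mn; rewrite nth_mkseq; last by apply: ltn_tindex => //; lia.
  by rewrite Tin // /cells_filled subn0 mn.
Qed.

(** * The ranking scan *)

(* Registers: 0 holds [n], 1 the position [i], 2 the constant 0, 3 tells whether
   node [i] has a child, 4 the total size of its subtrees, 5 tells whether it
   has a right sibling, 6 the total size of its right siblings' trees, 7 the
   rank of the forest of its subtrees.
   Arrays: 2 holds the sizes and [3 + d] the ranks of the forests
   [nth _ (sites _ _ _) i], where at most [d] trees are allowed. *)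

Definition pos1 : expr := Bin Add (Var 1) (Lit 1).

Definition sibling_pos : expr := Bin Add pos1 (Var 4).

(* With the codes 0, 1, 2, 3 of s, l, m, r and truncated subtraction,
   [1 - (y - 1)] tests for s or l and [1 - (1 - x * (3 - x))] for l or m. *)
Definition rank_head (D : nat) : seq stmt :=
  [:: Assign 3 (Bin Defs.Sub (Lit 1) (Bin Defs.Sub (Cell 0 pos1) (Lit 1)));
      Assign 4 (Bin Mul (Var 3) (Cell 2 pos1));
      Assign 5 (Bin Defs.Sub (Lit 1) (Bin Defs.Sub (Lit 1)
                 (Bin Mul (Cell 0 (Var 1)) (Bin Defs.Sub (Lit 3) (Cell 0 (Var 1))))));
      Assign 6 (Bin Mul (Var 5) (Cell 2 sibling_pos));
      Assign 7 (Bin Mul (Var 3) (Cell (3 + D) pos1));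
      Store 2 (Var 1) (Bin Add (Bin Add (Var 4) (Var 6)) (Lit 1))].

(** The recurrence [forest_rank_cons], with counts read on the diagonal of the table. Array 3, for
    bound 0, is never written and stays 0. *)
Definition rank_entry (d : nat) : stmt :=
  Store (3 + d) (Var 1)
    (Bin Add
       (Bin Add (tcell d (Bin Add (Bin Add (Var 4) (Var 6)) (Lit 1)) (Var 4))
                (Bin Mul (Var 7) (tcell d.-1 (Var 6) (Var 6))))
       (Bin Mul (Var 5) (Cell (3 + d.-1) sibling_pos))).

Definition rank_step (D : nat) : seq stmt :=
  rank_head D ++ map rank_entry (iota 1 D) ++
  [:: Assign 1 (Bin Defs.Sub (Var 1) (Lit 1))].

Definition rank_init : seq stmt := [:: Assign 1 (Bin Defs.Sub (Var 0) (Lit 1))].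

Definition rank_result (D : nat) : seq stmt :=
  [:: Assign 0 (Bin Add (Cell (3 + D) (Lit 1)) (Lit 1))].

(** The scan stops before the root: position 1 holds the forest of the root's children, or is past
    the end and 0 when [n = 1]. *)
Definition rank_program (D : nat) : program :=
  Seq (block rank_init)
      (Seq (While 2 1 (block (rank_step D))) (block (rank_result D))).

(** Treating the tree as an only child gives its root the label [Ls], as in the codeword. *)
Definition site (t : tree) (i : nat) : label * seq tree :=
  nth (Ls, [::]) (sites 1 0 [:: t]) i.

Definition ranks_above (D : nat) (t : tree) (i : nat) (st : state) : Prop :=
  (forall j, i < j -> arr st 2 j = fsize (site t j).2) /\
  (forall d j, d <= D -> (0 < d -> i < j) ->
     arr st (3 + d) j = forest_rank D d (site t j).2).

Definition rank_state (D n : nat) (t : tree) (T : nat -> nat) (i : nat)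
    (st : state) : Prop :=
  [/\ reg st 0 = n, reg st 1 = i, reg st 2 = 0 &
    [/\ forall j, arr st 0 j = label_code (site t j).1, arr st 1 =1 T
      & ranks_above D t i st]].

Lemma site_ok_at t i : i < nnodes t -> exists c ts,
    [/\ (site t i).2 = Node c :: ts,
        c = (if first_label (site t i.+1).1 then (site t i.+1).2 else [::])
      & ts = (if has_next_label (site t i).1
              then (site t (i.+1 + fsize c)).2 else [::])].
Proof.
move=> lti.
have nil_ok k : k < size (Nil (label * seq tree)) -> site_ok (drop k [::]) by [].
have := @sites_site_ok 1 0 [:: t] [::] erefl isT nil_ok i.
rewrite cats0 size_sites /fsize /= addn0 => /(_ lti) [c [ts [eqs eqc eqts]]].
move: eqs eqc eqts; rewrite !nth_drop addn0 addn1 addnS -addSn.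
by exists c, ts.
Qed.

Lemma nth_codeword t i :
  nth 0 (map label_code (codeword t)) i = label_code (site t i).1.
Proof.
have -> : codeword t = map fst (sites 1 0 [:: t]).
  by case: t => s; rewrite codewordE sites_cons cats0.
rewrite -map_comp /site; case: (ltnP i (size (sites 1 0 [:: t]))) => lti.
  by rewrite (nth_map (Ls, [::])).
by rewrite !nth_default // size_map.
Qed.

Lemma site1 t : (site t 1).2 = children t.
Proof.
by case: t => s; rewrite /site sites_cons cats0; case: s => [|[c] r].
Qed.

(** This is why the table rows [m < n] suffice. *)
Lemma ltn_fsize_site t i : 0 < i -> fsize (site t i).2 < nnodes t.
Proof.
case: t i => s [//|i] _; rewrite /site sites_cons cats0 ltnS /=.
exact: leq_fsize_sites.
Qed.

Lemma run_rank_entries n st i sz rest crank b k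
    (T : nat -> nat) (cr : nat -> nat) :
  reg st 0 = n -> reg st 1 = i -> reg st 4 = sz -> reg st 6 = rest ->
  reg st 7 = crank -> reg st 5 = b -> arr st 1 =1 T ->
  (forall d, b * arr st (3 + d) (i.+1 + sz) = cr d) ->
  reg (run st (map rank_entry (iota 1 k))) = reg st /\
  forall a j, arr (run st (map rank_entry (iota 1 k))) a j =
    if (3 < a <= 3 + k) && (j == i)
    then T (tindex n (a - 3) (sz + rest).+1 sz)
         + crank * T (tindex n (a - 4) rest rest) + cr (a - 4)
    else arr st a j.
Proof.
move=> r0 r1 r4 r6 r7 r5 aT acr.
elim: k => [|k [eqr eqa]]; first by split=> // a j; rewrite addn0; case: ifP => //; lia.
have -> : iota 1 k.+1 = iota 1 k ++ [:: k.+1] by rewrite -(addn1 k) iotaD add1n addn1.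
rewrite map_cat run_cat; move: (run st _) eqr eqa => st1 eqr eqa; split=> //.
move=> a j; rewrite /= {1}/upd.
have [->|nea] := eqVneq a (3 + k.+1); last first.
  by rewrite eqa; congr (if _ && _ then _ else _); lia.
rewrite /upd; have [->|nej] := eqVneq j i; last first.
  by rewrite eqr r1 (negPf nej) eqa (negPf nej) !andbF.
have aT1 : arr st1 1 =1 T by move=> q; rewrite eqa aT.
(* The sibling's cell lies beyond position [i], so earlier stores left it intact. *)
have ack : arr st1 (3 + k) (i.+1 + sz) = arr st (3 + k) (i.+1 + sz).
  by rewrite eqa ifF //; lia.
rewrite eqr r0 r1 r4 r5 r6 r7 eqxx -!/(tindex n _ _ _) !aT1 !addn1 ack acr.
rewrite ifT; last by lia.
by rewrite addKn -[4]addn1 -[3 + k.+1]addSnnS addKn.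
Qed.

Lemma exec_rank_step D n t T i st :
  nnodes t = n -> i.+1 < n ->
  (forall d m j, d <= D -> j <= m -> m < n ->
     T (tindex n d m j) = prefix_count D d m j) ->
  rank_state D n t T i.+1 st ->
  exists t' st', [/\ exec (block (rank_step D)) st t' st',
    t' <= cost_block (rank_step D) & rank_state D n t T i st'].
Proof.
move=> tn ltin Tok [r0 r1 r2 [aw aT [asz ark]]].
have [|st' e [ar aa]] := @exec_block (rank_step D) st.
  by rewrite !all_cat all_stmt_ok_map.
exists (cost_block (rank_step D)), st'; split=> //.
have [c [ts [eqs eqc eqts]]] :=
  @site_ok_at t i.+1 (leq_trans ltin (eq_leq (esym tn))).
(* Multiplication by a 0/1 test replaces branching; 0 is the correct size and rank of the empty
   forest. *)
have child x y : (1 - (label_code x - 1)) * y = if first_label x then y else 0.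
  by case: x; rewrite ?mul1n ?mul0n.
have next x y : (1 - (1 - label_code x * (3 - label_code x))) * y =
    if has_next_label x then y else 0.
  by case: x; rewrite ?mul1n ?mul0n.
move: ar aa; rewrite /rank_step !run_cat; set st1 := run st (rank_head D).
have q0 : reg st1 0 = n by exact: r0.
have q1 : reg st1 1 = i.+1 by exact: r1.
have q2 : reg st1 2 = 0 by exact: r2.
have q4 : reg st1 4 = fsize c.
  rewrite -[LHS]/((1 - (arr st 0 (reg st 1 + 1) - 1)) * arr st 2 (reg st 1 + 1)).
  by rewrite r1 addn1 aw child asz // eqc; case: ifP.
have q5 : reg st1 5 = 1 - (1 - label_code (site t i.+1).1 *
                               (3 - label_code (site t i.+1).1)).
  by rewrite -aw -r1.
have q6 : reg st1 6 = fsize ts.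
  rewrite -[LHS]/(reg st1 5 * arr st 2 (reg st 1 + 1 + reg st1 4)).
  rewrite q5 q4 r1 addn1 next asz; last by lia.
  by rewrite eqts; case: ifP.
have q7 : reg st1 7 = forest_rank D D c.
  rewrite -[LHS]/((1 - (arr st 0 (reg st 1 + 1) - 1)) * arr st (3 + D) (reg st 1 + 1)).
  by rewrite r1 addn1 aw child ark // eqc; case: ifP => //; case: (D).
have qT : arr st1 1 =1 T by exact: aT.
have qr d : d <= D -> reg st1 5 * arr st1 (3 + d) (i.+2 + fsize c) = forest_rank D d ts.
  move=> dD; rewrite -[arr st1 _]/(arr st (3 + d)) q5 next ark //; last by lia.
  by rewrite eqts; case: ifP => //; case: (d).
have [] := @run_rank_entries n st1 _ _ _ _ _ D T _
  q0 q1 q4 q6 q7 erefl qT (fun=> erefl).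
move: (run st1 _) => st2 eqr eqa ar aa.
rewrite /= in ar aa.
have fs : fsize (site t i.+1).2 = (fsize c + fsize ts).+1 by rewrite eqs fsize_cons.
have lt_fs : (fsize c + fsize ts).+1 < n by rewrite -fs -tn ltn_fsize_site.
split; first by rewrite ar // /upd /= eqr.
- by rewrite ar // /upd /= eqr q1 subn1.
- by rewrite ar // /upd /= eqr.
rewrite aa; split=> [j|j|].
- by rewrite eqa; apply: aw.
- by rewrite eqa; apply: aT.
split=> [j ltj|d j dD ltj].
  rewrite aa eqa /=.
  rewrite -[LHS]/(upd (arr st 2) (reg st 1) (reg st1 4 + reg st1 6 + 1) j).
  rewrite r1 q4 q6 addn1 /upd; case: eqP => [->|nej]; first by rewrite fs.
  by rewrite asz //; lia.
rewrite aa eqa -[arr st1 (3 + d) j]/(arr st (3 + d) j).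
case: (eqVneq j i.+1) => [->|nej]; last by rewrite andbF ark //; lia.
case: d dD {ltj} => [|d] dD; first by rewrite ark.
rewrite ifT; last by lia.
have -> : 3 + d.+1 - 3 = d.+1 by lia.
have -> : 3 + d.+1 - 4 = d by lia.
have [lt1 lt2] : fsize c <= (fsize c + fsize ts).+1 /\ fsize ts < n by lia.
rewrite !Tok //; last exact: ltnW.
by rewrite qr 1?ltnW // eqs forest_rank_cons prefix_count_diag.
Qed.

Lemma ranks_rank_program D n table t :
  0 < n -> t \in TDelta D n ->
  (forall d m j, d <= D -> j <= m -> m < n ->
     nth 0 table (tindex n d m j) = prefix_count D d m j) ->
  ranks (rank_program D) D n
    ((cost_block (rank_step D) + cost_block (rank_result D) + 20) * n) table t.
Proof.
move=> n0 tT Tok; have tn : nnodes t = n by case/andP: tT => _ /eqP.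
set st := init_state n (map label_code (codeword t)) table.
have [t1 [st1 [e1 le1 [a1 b1]]]] :=
  @exec_assign 1 (Bin Defs.Sub (Var 0) (Lit 1)) st isT isT.
(* Past the last node all forests are empty, so the initial zeros satisfy the invariant. *)
have site_nil j : n.-1 < j -> (site t j).2 = [::].
  move=> ltj; rewrite /site nth_default // size_sites /fsize /= addn0; lia.
have S1 : n.-1 < n /\ rank_state D n t (nth 0 table) n.-1 st1.
  split; first by lia.
  split; rewrite ?a1 //= /upd /= ?subn1 //.
  split=> [j|j|]; rewrite ?b1 //.
    exact: nth_codeword.
  split=> [j|d j dD ltj]; rewrite b1; first by move=> /site_nil ->.
  rewrite -[LHS]/0; case: d ltj {dD} => // d ltj; rewrite site_nil //.
  exact: ltj.
pose I i s := i < n /\ rank_state D n t (nth 0 table) i s.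
have step k s : I k.+1 s -> reg s 2 < reg s 1 /\ exists t s',
    [/\ exec (block (rank_step D)) s t s', t <= cost_block (rank_step D) & I k s'].
  case=> ltk Sk; split; first by case: Sk => _ -> -> _.
  have [t' [s' [es les Ss]]] := exec_rank_step tn ltk Tok Sk.
  by exists t', s'; split=> //; split=> //; apply: ltnW.
have stop s : I 0 s -> reg s 1 <= reg s 2 by case=> _ [_ -> -> _].
have [t2 [st2 [e2 le2 [_ [_ _ _ [_ _ [_ rk2]]]]]]] := exec_while step stop S1.
have [t3 [st3 [e3 le3 [a3 b3]]]] :=
  @exec_assign 0 (Bin Add (Cell (3 + D) (Lit 1)) (Lit 1)) st2 isT isT.
exists (t1 + (t2 + t3)), st3; split.
- exact: exec_Seq e1 (exec_Seq e2 e3).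
- have n1 : n.-1 <= n by lia.
  have := leq_mul n1 (leqnn (cost_block (rank_step D)).+1).
  move: le1 le2 le3; rewrite /rank_result {1}/cost_block /=.
  move: (cost_block _) (cost_block _) => a b; nia.
rewrite a3 // /upd /= rk2 // site1 addn1.
by case: (t) tT => s; apply: is_rank_forest_rank.
Qed.

Theorem theorem5 (Delta : nat) (hDelta : 2 <= Delta) :
  exists (pre rk : program) (C : nat), forall n : nat, 0 < n ->
    exists table : seq nat,
      [/\ size table <= C * n ^ 2,
          precomputes pre n (C * n ^ 2) table
        & forall t : tree, t \in TDelta Delta n ->
            ranks rk Delta n (C * n) table t].
Proof.
set c1 := cost_block (pre_init Delta) + cost_block (pre_step Delta) + 23.
set c2 := cost_block (rank_step Delta) + cost_block (rank_result Delta) + 20.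
(* The summands bound table size, precomputation time and ranking time; they depend on [Delta]
   alone. *)
exists (pre_program Delta), (rank_program Delta), (Delta.+1 + c1 + c2) => n n0.
have [table [sz [k [st [e le T]]] Tok]] := precomputes_table Delta n0.
exists table; split.
- by apply: leq_trans sz _; rewrite leq_mul2r; lia.
- by exists k, st; split=> //; apply: leq_trans le _; rewrite leq_mul2r; lia.
- move=> t tT; have [k' [st' [e' le' r]]] := ranks_rank_program n0 tT Tok.
  by exists k', st'; split=> //; apply: leq_trans le' _; rewrite leq_mul2r; lia.
Qed.
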